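(* Let $p\in\mathbb{R}$ and $q>0$, and let $\mathcal{H}:[0,+\infty)\to\mathbb{R}$ be continuous and nonnegative on $[0,+\infty)$, differentiable on $(0,+\infty)$, and such that the limit $\mathcal{H}'(0^+)=\lim_{\gamma\to0^+}\mathcal{H}'(\gamma)$ exists in $[-\infty,+\infty]$. Consider the problem $$\min_{\gamma\ge 0}\ \mathcal{L}(\gamma)=-\frac12\frac{p^2\gamma}{1+q\gamma}+\frac12\log(1+q\gamma)+\mathcal{H}(\gamma)$$ and its KKT conditions in $(\gamma,\mu)$: $$\frac12\frac{q^2\gamma+(q-p^2)}{(1+q\gamma)^2}+\mathcal{H}'(\gamma)-\mu=0,\qquad \mu\ge0,\ \gamma\ge0,\qquad \mu\gamma=0 .\tag{KKT}$$ A point $\gamma^\star$ is said to satisfy (KKT) if there is a multiplier $\mu$ such that $(\gamma^\star,\mu)$ satisfies (KKT). Then: (I) If $\gamma^\star=0$ satisfies (KKT), then $q-p^2\ge -2\mathcal{H}'(0^+)$. (II) If $q-p^2>-2\mathcal{H}'(0^+)$, then $\gamma^\star=0$ satisfies (KKT). (III) A point $\gamma^\star>0$ satisfies (KKT) if and only if it is a positive root of $$\frac12\frac{q^2\gamma+(q-p^2)}{(1+q\gamma)^2}+\mathcal{H}'(\gamma)=0 .$$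
   Context: At $\gamma=0$ the term $\mathcal{H}'(\gamma)$ in the KKT conditions is read as $\mathcal{H}'(0^+)$. When $\mathcal{H}'(0^+)$ is infinite, the stationarity condition at $\gamma=0$ is read in the extended reals, i.e. $\mu=\frac{q-p^2}{2}+\mathcal{H}'(0^+)\in\{-\infty,+\infty\}$, with $\mu=+\infty$ an admissible multiplier at $\gamma=0$ (and $\infty\cdot 0=0$). The fraction in the stationarity condition is the derivative of the first two terms of $\mathcal{L}$. *)

(* Defs.v *)
From HB Require Import structures.
From mathcomp Require Import all_boot all_order all_algebra.
From mathcomp Require Import ring lra.
From mathcomp Require Import all_classical all_reals all_analysis.

Set Implicit Arguments.
Unset Strict Implicit.
Unset Printing Implicit Defensive.

Import Order.TTheory GRing.Theory Num.Theory.
Import numFieldNormedType.Exports.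

Local Open Scope ring_scope.
Local Open Scope classical_set_scope.

(* A function on [0, +oo[ is a total function H : R -> R; its values on
   ]-oo, 0[ are never constrained, and neither they nor the two-sided
   derivative of H at 0 enter the conditions below. *)

Definition objective_smooth (R : realType) (p q g : R) : R :=
  - (2^-1 * (p ^+ 2 * g / (1 + q * g))) + 2^-1 * ln (1 + q * g).

Definition objective (R : realType) (p q : R) (H : R -> R) (g : R) : R :=
  objective_smooth p q g + H g.

Definition dobjective_smooth (R : realType) (p q g : R) : R :=
  2^-1 * ((q ^+ 2 * g + (q - p ^+ 2)) / (1 + q * g) ^+ 2).

Lemma is_derive_objective_smooth (R : realType) (p q g : R) :
  0 < q -> 0 <= g ->
  is_derive g 1 (objective_smooth p q) (dobjective_smooth p q g).
Proof.
move=> q0 g0.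
have d0 : 0 < 1 + q * g by rewrite ltr_pwDl// mulr_ge0// ltW.
have dn0 := lt0r_neq0 d0.
have Dd : is_derive g 1 (fun x : R => 1 + q * x) q.
  by apply: is_derive_eq; rewrite /GRing.scale/=; ring.
have Dln : is_derive g 1 (fun x : R => ln (1 + q * x)) ((1 + q * g)^-1 * q).
  exact: (@is_derive1_comp _ (@ln R) (fun x => 1 + q * x) g _ _
            (is_derive1_ln d0) Dd).
have Dinv : is_derive g 1 (fun x : R => (1 + q * x)^-1)
    (- (1 + q * g) ^- 2 *: q).
  exact: is_deriveV.
rewrite /objective_smooth /dobjective_smooth.
apply: is_derive_eq; rewrite /GRing.scale/=.
by field.
Qed.

Lemma is_derive_objective (R : realType) (p q : R) (H : R -> R) (g : R) :
  0 < q -> 0 <= g -> derivable H g 1 ->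
  is_derive g 1 (objective p q H) (dobjective_smooth p q g + derive1 H g).
Proof.
move=> q0 g0 /derivableP dH.
rewrite derive1E; have dS := is_derive_objective_smooth p q0 g0.
exact: is_deriveD.
Qed.

(* H'(0^+), in the extended reals; meaningful when the limit exists. *)
Definition rderive0 (R : realType) (H : R -> R) : \bar R :=
  lim ((derive1 H x)%:E @[x --> 0^'+]).

(* H'(g) for g >= 0, read as H'(0^+) at g = 0. *)
Definition ederive (R : realType) (H : R -> R) (g : R) : \bar R :=
  if g == 0 then rderive0 H else (derive1 H g)%:E.

(* Stationarity is solved for mu, because +oo - +oo is not 0 in \bar R; for
   finite mu this is the same equation as "... - mu = 0". In \bar R one has
   +oo * 0 = 0 and +oo * g = +oo for g > 0, so complementarity allows
   mu = +oo at g = 0 only. *)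
Definition KKT (R : realType) (p q : R) (H : R -> R) (g : R) (mu : \bar R)
    : Prop :=
  [/\ mu = ((dobjective_smooth p q g)%:E + ederive H g)%E,
      (0 <= mu)%E, 0 <= g & (mu * g%:E = 0)%E].

Definition satisfies_KKT (R : realType) (p q : R) (H : R -> R) (g : R) : Prop :=
  exists mu : \bar R, KKT p q H g mu.

(* Main.v *)
Require Import Defs.
From HB Require Import structures.
From mathcomp Require Import all_boot all_order all_algebra.
From mathcomp Require Import lra.
From mathcomp Require Import all_classical all_reals all_analysis.

Set Implicit Arguments.
Unset Strict Implicit.
Unset Printing Implicit Defensive.

Import Order.TTheory GRing.Theory Num.Theory.
Import numFieldNormedType.Exports.

Local Open Scope ring_scope.
Local Open Scope classical_set_scope.

(** Stationarity determines [mu], so only its sign and complementarity remain to be checked. At 0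
    complementarity is automatic, and [mu] is (q - p^2)/2 + H'(0^+); by [objective_slope0_ge0], its
    nonnegativity is exactly the inequality q - p^2 >= -2 H'(0^+), whence (I) and (II). At g > 0
    complementarity forces [mu] = 0, which turns stationarity into the root equation. *)

(** For finite [h] this is multiplication by 2. Since -2 swaps the infinities, both sides are true
    at +oo and both false at -oo. *)
Lemma objective_slope0_ge0 (R : realType) (p q : R) (h : \bar R) :
  (0 <= (dobjective_smooth p q 0)%:E + h)%E =
  ((- 2)%:E * h <= (q - p ^+ 2)%:E)%E.
Proof.
rewrite /dobjective_smooth !mulr0 add0r addr0 expr1n divr1.
case: h => [r| |].
- by rewrite -EFinD -EFinM !lee_fin; apply/idP/idP => ?; lra.
- by rewrite addey// lt0_muley ?lte_fin ?oppr_lt0// leey leNye.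
- by rewrite addeNy lt0_muleNy ?lte_fin ?oppr_lt0// !leNgt ltNyr ltry.
Qed.

Theorem theorem3p1 (R : realType) (p q : R) (H : R -> R)
  (q_gt0 : 0 < q)
  (H_cont : {within `[0, +oo[, continuous H})
  (H_ge0 : forall g : R, 0 <= g -> 0 <= H g)
  (H_derivable : forall g : R, 0 < g -> derivable H g 1)
  (dH_cvg : cvg ((derive1 H x)%:E @[x --> (0 : R)^'+])) :
  [/\ satisfies_KKT p q H 0 ->
        ((q - p ^+ 2)%:E >= (- 2)%:E * rderive0 H)%E,
      ((q - p ^+ 2)%:E > (- 2)%:E * rderive0 H)%E ->
        satisfies_KKT p q H 0
    & forall g : R, 0 < g ->
        (satisfies_KKT p q H g <->
         2^-1 * ((q ^+ 2 * g + (q - p ^+ 2)) / (1 + q * g) ^+ 2) + derive1 H g = 0)].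
Proof.
split.
- case=> mu [+ mu_ge0 _ _]; rewrite /ederive eqxx => mu_def.
  by rewrite -objective_slope0_ge0 -mu_def.
- move=> /ltW; rewrite -objective_slope0_ge0 => slope_ge0.
  exists ((dobjective_smooth p q 0)%:E + rderive0 H)%E.
  (* [mule0] holds in all of [\bar R], so complementarity covers the multiplier +oo. *)
  by split; rewrite ?mule0// /ederive eqxx.
- move=> g g_gt0; rewrite /satisfies_KKT /KKT /ederive (gt_eqF g_gt0).
  split=> [[mu [-> _ _]]|root_g].
    (* Away from 0 the multiplier is finite, so [mu * g = 0] is an equation in the field [R] and g
       can be cancelled. *)
    rewrite -EFinD -EFinM => -[] /eqP.
    by rewrite mulf_eq0 (gt_eqF g_gt0) orbF => /eqP.
  exists 0%E; split; [|by []|exact: ltW|exact: mul0e].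
  by rewrite -EFinD; congr EFin; rewrite -[LHS]root_g.
Qed.
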